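(* Let $n,m\geq 2$ be integers such that $n$ divides $m$ (equivalently, $\mathbb{Z}_n$ is a $\mathbb{Z}_m$-module). Then $G_n(\mathbb{Z}_m)$ is perfect if and only if $n$ has at most four distinct prime divisors.
   Context: $\mathbb{Z}_k$ denotes the ring of integers modulo $k$. When $n$ divides $m$, $\mathbb{Z}_n$ is regarded as a $\mathbb{Z}_m$-module in the natural way. $G_n(\mathbb{Z}_m)$ is the $\mathbb{Z}_n$-intersection graph of ideals of $\mathbb{Z}_m$: the (simple) graph whose vertices are the non-trivial ideals of $\mathbb{Z}_m$ (ideals different from $0$ and $\mathbb{Z}_m$), where two distinct vertices $I$ and $J$ are adjacent if and only if $I\mathbb{Z}_n\cap J\mathbb{Z}_n\neq 0$. A graph $G$ is perfect if $\chi(H)=\omega(H)$ for every induced subgraph $H$ of $G$, where $\chi$ is the chromatic number and $\omega$ the clique number (number of vertices in a largest clique). *)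

(* Defs.v *)
From HB Require Import structures.
From mathcomp Require Import all_boot all_algebra.

Set Implicit Arguments.
Unset Strict Implicit.
Unset Printing Implicit Defensive.

Import GRing.Theory.
Local Open Scope ring_scope.

Record sgraph := SGraph {
  vertex :> finType;
  edge : rel vertex;
  edge_sym : symmetric edge;
  edge_irrefl : irreflexive edge }.

Arguments edge {s}.

Section Induced.
Variables (G : sgraph) (A : {set G}).

Definition induced_edge : rel {x : G | x \in A} :=
  fun x y => edge (val x) (val y).

Lemma induced_edge_sym : symmetric induced_edge.
Proof. by move=> x y; apply: edge_sym. Qed.

Lemma induced_edge_irrefl : irreflexive induced_edge.
Proof. by move=> x; apply: edge_irrefl. Qed.

Definition induced : sgraph := SGraph induced_edge_sym induced_edge_irrefl.
End Induced.

Section Perfect.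
Implicit Type G : sgraph.

Definition clique G (K : {set G}) : bool :=
  [forall x in K, forall y in K, (x != y) ==> edge x y].

Definition omega G : nat := \max_(K : {set G} | clique K) #|K|.

Definition colorable G (k : nat) : bool :=
  [exists f : {ffun G -> 'I_k},
     [forall x, forall y, edge x y ==> (f x != f y)]].

Lemma colorable_ex G : exists k, colorable G k.
Proof.
exists #|G|; apply/existsP; exists [ffun x => enum_rank x].
apply/forallP=> x; apply/forallP=> y; apply/implyP=> xy.
rewrite !ffunE (inj_eq enum_rank_inj).
by apply: contraTneq xy => ->; rewrite edge_irrefl.
Qed.

Definition chi G : nat := ex_minn (colorable_ex G).

Definition perfect G : Prop :=
  forall A : {set G}, chi (induced A) = omega (induced A).
End Perfect.

Section Ideals.
Variable R : finComNzRingType.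

Definition ideal (I : {set R}) : bool :=
  (0 \in I) && [forall a, forall x in I, forall y in I, a * x + y \in I].

Definition nontrivial_ideal (I : {set R}) : bool :=
  [&& ideal I, I != [set 0] & I != [set: R]].

Variable M : finLmodType R.

Definition submodule (N : {set M}) : bool :=
  (0 \in N) && [forall a : R, forall x in N, forall y in N, a *: x + y \in N].

(* The submodule I M, that is, the one generated by the products a *: x. *)
Definition ideal_mul (I : {set R}) : {set M} :=
  \bigcap_(N : {set M} |
             submodule N && ([set a *: x | a in I, x in [set: M]] \subset N)) N.

Definition ideal_edge : rel {I : {set R} | nontrivial_ideal I} :=
  fun I J => (I != J) &&
    (ideal_mul (val I) :&: ideal_mul (val J) != [set 0]).

Lemma ideal_edge_sym : symmetric ideal_edge.
Proof. by move=> I J; rewrite /ideal_edge eq_sym setIC. Qed.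

Lemma ideal_edge_irrefl : irreflexive ideal_edge.
Proof. by move=> I; rewrite /ideal_edge eqxx. Qed.

Definition ideal_graph : sgraph := SGraph ideal_edge_sym ideal_edge_irrefl.
End Ideals.

Section ZnModule.
Variables (m n : nat) (m_gt1 : (1 < m)%N) (n_gt1 : (1 < n)%N) (n_dvd_m : (n %| m)%N).

(* Type synonym of 'Z_n on which the natural action of 'Z_m is declared; the
   hypotheses are parameters because the action exists only under them. *)
Definition ZnMod of (1 < m)%N & (1 < n)%N & (n %| m)%N : Type := 'Z_n.

Local Notation V := (ZnMod m_gt1 n_gt1 n_dvd_m).

HB.instance Definition _ := FinRing.Zmodule.copy V 'Z_n.

(* The action by multiplication by the residue of a modulo n. *)
Definition ZnMod_scale (a : 'Z_m) (x : V) : V := ((a : nat)%:R : 'Z_n) * (x : 'Z_n).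

Lemma natr_modm (k : nat) : (k %% (Zp_trunc m).+2)%:R = k%:R :> 'Z_n.
Proof.
rewrite -(Zp_nat_mod n_gt1) -[RHS](Zp_nat_mod n_gt1) (Zp_cast m_gt1).
by rewrite modn_dvdm.
Qed.

Lemma ZnMod_scaleA a b x :
  ZnMod_scale a (ZnMod_scale b x) = ZnMod_scale (a * b) x.
Proof. by rewrite /ZnMod_scale /= natr_modm natrM mulrA. Qed.

Lemma ZnMod_scale1 : left_id 1 ZnMod_scale.
Proof. by move=> x; rewrite /ZnMod_scale /= mul1r. Qed.

Lemma ZnMod_scaleDr : right_distributive ZnMod_scale +%R.
Proof. by move=> a x y; apply: mulrDr. Qed.

Lemma ZnMod_scaleDl x : {morph ZnMod_scale^~ x : a b / a + b}.
Proof.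
by move=> a b; rewrite /ZnMod_scale /= natr_modm natrD; apply: mulrDl.
Qed.

HB.instance Definition _ := GRing.Zmodule_isLmodule.Build 'Z_m V
  ZnMod_scaleA ZnMod_scale1 ZnMod_scaleDr ZnMod_scaleDl.
End ZnModule.

Definition Zn_graph (m n : nat) (m_gt1 : (1 < m)%N) (n_gt1 : (1 < n)%N)
    (n_dvd_m : (n %| m)%N) : sgraph :=
  ideal_graph (ZnMod m_gt1 n_gt1 n_dvd_m : finLmodType 'Z_m).

(* Main.v *)
(* Send a submodule N of Z_n to the set of primes p | n with n/p \in N.  Two
   submodules meet nontrivially iff these sets meet, so the graph is the
   intersection graph of a family of subsets of the set of primes of n.

   If there are at most four primes, colour greedily by decreasing size of the
   subsets.  Whenever all colours of a clique Q exceed i, some vertex of colour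
   i is adjacent to all of Q; hence the colours in use are those of a clique.

   If p_0, ..., p_4 are distinct primes dividing n, the ideals generated by
   n / (p_i p_(i+1)), indices modulo 5, induce a 5-cycle, with chromatic number
   3 and clique number 2. *)

Require Import Defs.
From mathcomp Require Import all_boot all_algebra.
From mathcomp Require Import zify.

Set Implicit Arguments.
Unset Strict Implicit.
Unset Printing Implicit Defensive.

Import GRing.Theory.

(** * Colouring intersection graphs of subsets of a four-point set *)

Lemma omega_le_chi (G : sgraph) : omega G <= chi G.
Proof.
rewrite /chi; case: ex_minnP => k /existsP[f /forallP fP] _.
apply/bigmax_leqP => K /forallP clK.
rewrite -[k]card_ord -(card_in_imset (f := f) (D := mem K)) ?max_card //.
move=> x y xK yK eqf; apply/eqP/contraT => neq.
have /implyP/(_ xK)/forallP/(_ y)/implyP/(_ yK)/implyP/(_ neq) xy := clK x.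
by have := forallP (fP x) y; rewrite xy eqf eqxx.
Qed.

Section IntersectionGraph.
Variables (G : sgraph) (T : finType) (L : G -> {set T}).
Hypothesis edgeE : forall x y, edge x y = (x != y) && (L x :&: L y != set0).

(** Colour a list sorted by increasing [#|L x|] from its tail: the head comes last and takes the
    least colour absent from its coloured neighbours. Each smaller colour is then blocked by a
    neighbour whose set is at least as large. *)
Lemma greedy_coloring :
  exists f : G -> nat, (forall x y, edge x y -> f x != f y) /\
    (forall x i, i < f x -> exists y, [/\ edge x y, f y = i & #|L x| <= #|L y|]).
Proof.
pose r (x y : G) := #|L x| <= #|L y|.
have rtr : transitive r by move=> y x z; apply: leq_trans.
have rtot : total r by move=> x y; apply: leq_total.
suff [f [fP fG]] : exists f : G -> nat,
    {in sort r (enum G) &, forall x y, edge x y -> f x != f y} /\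
    {in sort r (enum G), forall x i, i < f x -> exists y,
       [/\ edge x y, f y = i & #|L x| <= #|L y|]}.
  exists f; split=> [x y|x]; first by apply: fP; rewrite mem_sort mem_enum.
  by apply: fG; rewrite mem_sort mem_enum.
have: pairwise r (sort r (enum G)) by rewrite -sorted_pairwise // sort_sorted.
have: uniq (sort r (enum G)) by rewrite sort_uniq enum_uniq.
suff H s : uniq s -> pairwise r s -> exists f : G -> nat,
    {in s &, forall x y, edge x y -> f x != f y} /\
    {in s, forall x i, i < f x -> exists2 y, y \in s &
       [/\ edge x y, f y = i & #|L x| <= #|L y|]}.
  move=> u p; have [f [fP fG]] := H _ u p; exists f; split=> // x xs i lti.
  by have [y _ yP] := fG x xs i lti; exists y.
elim: s => [|x s IH] /=; first by exists (fun=> 0).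
move=> /andP[xs us] /andP[/allP rx ps].
have [f [fP fG]] := IH us ps.
pose free j := all (fun y => edge x y ==> (f y != j)) s.
have free_ex : exists j, free j.
  exists (\max_(y <- s) f y).+1; apply/allP => y ys; apply/implyP => _.
  by rewrite neq_ltn ltnS (leq_bigmax_seq _ ys).
case: (ex_minnP free_ex) => c /allP cfree cmin.
pose g y := if y == x then c else f y.
have gs y : y \in s -> g y = f y.
  by rewrite /g; case: eqP => // ->; rewrite (negPf xs).
have gx : g x = c by rewrite /g eqxx.
exists g; split=> [y z|y].
  rewrite !inE => /predU1P[->|ys] /predU1P[->|zs]; rewrite ?gx ?gs //.
  - by rewrite edge_irrefl.
  - by move=> xz; rewrite eq_sym; apply: (implyP (cfree z zs)).
  - by rewrite edge_sym; apply/implyP/cfree.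
  - exact: fP.
rewrite inE => /predU1P[->|ys] i; rewrite ?gx ?gs // => lti; last first.
  have [z zs [yz fz Lz]] := fG y ys i lti.
  by exists z; rewrite ?inE ?zs ?orbT // gs.
have /allPn[z zs] : ~~ free i by apply: contraTN lti => /cmin; rewrite -leqNgt.
rewrite negb_imply negbK => /andP[xz /eqP fz].
by exists z; rewrite ?inE ?zs ?orbT // gs //; split=> //; apply: rx.
Qed.

Hypothesis cardT : #|T| <= 4.

(** Take [a] in [Q] and its neighbour [p] of colour [i]. If [p] misses some [v] in [Q], take
    likewise a neighbour [q] of [v]: sharing a colour, [p] and [q] have disjoint sets. On at most
    four points the size bounds force [L v] into [L q]; every member of [Q] meets [L v], so [q] is
    adjacent to all of [Q]. *)
Lemma clique_extension (f : G -> nat) (Q : {set G}) (i : nat) :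
    (forall x y, edge x y -> f x != f y) ->
    (forall x i, i < f x -> exists y, [/\ edge x y, f y = i & #|L x| <= #|L y|]) ->
    clique Q -> Q != set0 -> {in Q, forall x, i < f x} ->
  exists2 p, f p = i & {in Q, forall x, edge p x}.
Proof.
move=> fP fG clQ /set0Pn[a aQ] ltQ.
have meetQ x y : x \in Q -> y \in Q -> x != y -> L x :&: L y != set0.
  move=> xQ yQ neq; have /forallP/(_ x)/implyP/(_ xQ) := clQ.
  move=> /forallP/(_ y)/implyP/(_ yQ)/implyP/(_ neq).
  by rewrite edgeE neq.
have edgeQ p x : f p = i -> x \in Q -> edge p x = (L p :&: L x != set0).
  move=> fp xQ; rewrite edgeE; case: eqP => // px.
  by have := ltQ x xQ; rewrite -px fp ltnn.
have [p [ap fp Lap]] := fG a i (ltQ a aQ).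
case: (boolP [forall x in Q, edge p x]) => [/forall_inP pQ | ]; first by exists p.
rewrite negb_forall_in => /exists_inP[v vQ]; rewrite (edgeQ p v) // negbK => /eqP pv.
have [q [vq fq Lvq]] := fG v i (ltQ v vQ).
have pa : L a :&: L p != set0 by move: ap; rewrite edgeE => /andP[].
have {}vq : L v :&: L q != set0 by move: vq; rewrite edgeE => /andP[].
have neq_pq : p != q by apply: contraNneq vq => <-; rewrite setIC pv.
have pq : L p :&: L q = set0.
  apply/eqP; apply: contraT => pq.
  by have := fP p q; rewrite edgeE neq_pq pq fp fq eqxx => /(_ isT).
have neq_av : a != v by apply: contraNneq pa => ->; rewrite setIC pv.
have va := meetQ _ _ aQ vQ neq_av.
(* [L a] meets both [L p] and [L v], which are disjoint. *)
have La2 : 1 < #|L a|.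
  have [s] := set0Pn _ pa; rewrite inE => /andP[sa sp].
  have [t] := set0Pn _ va; rewrite inE => /andP[ta tv].
  apply/card_gt1P; exists s, t; split=> //.
  by apply: contraTneq tv => <-; apply/negP => sv; have := in_set0 s; rewrite -pv inE sp sv.
have card_pq : #|L p| + #|L q| = #|L p :|: L q| by rewrite cardsU pq cards0 subn0.
(* |L p| >= 2, so L q is either the complement of L p or a single point. *)
have vq_sub : L v \subset L q.
  have [q2|q1] := ltnP 1 #|L q|.
    have /eqP full : L p :|: L q == setT.
      by rewrite eqEcard subsetT cardsT -card_pq; lia.
    apply/subsetP => s sv; have := in_setT s; rewrite -full inE.
    by case/orP=> // sp; have := in_set0 s; rewrite -pv inE sp sv.
  have /eqP <- : L v :&: L q == L v; last exact: subsetIr.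
  rewrite eqEcard subsetIl /=.
  by move: vq; rewrite -card_gt0; lia.
exists q => // x xQ; rewrite edgeQ //.
have [->|neq] := eqVneq x v; first by rewrite setIC.
apply: contraNneq (meetQ _ _ vQ xQ _) => [qx|]; last by rewrite eq_sym.
by rewrite -subset0 -qx setSI.
Qed.

Lemma chi_eq_omega : chi G = omega G.
Proof.
apply/eqP; rewrite eqn_leq omega_le_chi andbT.
have [f [fP fG]] := greedy_coloring.
suff f_lt x : f x < omega G.
  rewrite /chi; case: ex_minnP => k _ -> //.
  apply/existsP; exists [ffun x => Ordinal (f_lt x)].
  apply/forallP => x; apply/forallP => y; apply/implyP => xy.
  by rewrite !ffunE -val_eqE; apply: fP.
(* Starting from [x], grow a clique downwards, one colour at a time; at [d = f x] it has [(f x).+1]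
   vertices, whence [f x < omega G]. *)
suff /(_ (f x) (leqnn _))[Q clQ []] : forall d, d <= f x -> exists2 Q : {set G},
    clique Q & #|Q| = d.+1 /\ {in Q, forall y, f x - d <= f y}.
  by move=> <- _; apply: (leq_bigmax_cond (P := @clique G) (F := fun K => #|K|)).
elim=> [_|d IH ltd].
  exists [set x]; last by rewrite cards1; split=> // y /set1P->; rewrite subn0.
  apply/forall_inP => y /set1P->; apply/forall_inP => z /set1P->.
  by rewrite eqxx.
have [Q clQ [cardQ ltQ]] := IH (ltnW ltd).
have Q0 : Q != set0 by rewrite -card_gt0 cardQ.
have ltQ' : {in Q, forall y, f x - d.+1 < f y} by move=> y /ltQ; lia.
have [p fp pQ] := clique_extension fP fG clQ Q0 ltQ'.
have pNQ : p \notin Q by apply/negP => /pQ; rewrite edge_irrefl.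
exists (p |: Q); last first.
  rewrite cardsU1 pNQ cardQ; split=> // y /setU1P[->|/ltQ']; [by rewrite fp|exact: ltnW].
apply/forall_inP => y /setU1P[->|yQ]; apply/forall_inP => z /setU1P[->|zQ].
- by rewrite eqxx.
- by rewrite pQ ?implybT.
- by rewrite edge_sym pQ ?implybT.
- exact: (forall_inP (forall_inP clQ y yQ) z zQ).
Qed.

End IntersectionGraph.

(** Restricting [L] presents every induced subgraph as an intersection graph over the same [T]. *)
Lemma intersection_graph_perfect (G : sgraph) (T : finType) (L : G -> {set T}) :
    (forall x y, edge x y = (x != y) && (L x :&: L y != set0)) ->
  #|T| <= 4 -> perfect G.
Proof.
move=> edgeE cardT A; apply: (@chi_eq_omega (induced A) T (fun x => L (val x)) _ cardT) => x y.
by rewrite /= /induced_edge edgeE val_eqE.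
Qed.

(** * The 5-cycle as an obstruction to perfection *)

Definition cycle5 (i j : 'I_5) : bool := (j == i.+1 %% 5 :> nat) || (i == j.+1 %% 5 :> nat).

Lemma cycle5_not_perfect (G : sgraph) (v : 'I_5 -> G) :
  (forall i j, edge (v i) (v j) = cycle5 i j) -> ~ perfect G.
Proof.
move=> edge_v; set A := v @: setT => /(_ A) eq_chi.
have vA i : v i \in A by apply: imset_f.
have omega2 : omega (induced A) <= 2.
  apply/bigmax_leqP => K clK; rewrite leqNgt; apply/negP.
  case/card_gt2P => -[x xA] [[y yA] [[z zA] [[xK yK zK] [xy yz zx]]]].
  have adj u w : u \in K -> w \in K -> u != w -> edge (val u) (val w).
    move=> uK wK neq; have /forall_inP/(_ u uK)/forall_inP/(_ w wK) := clK.
    by rewrite neq.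
  have := adj _ _ xK yK xy; have := adj _ _ yK zK yz; have := adj _ _ zK xK zx.
  move: xA yA zA {xK yK zK xy yz zx} => /= /imsetP[i _ ->] /imsetP[j _ ->] /imsetP[k _ ->].
  rewrite !edge_v /cycle5.
  (* No three vertices of the 5-cycle form a triangle. *)
  by case: i j k => [[|[|[|[|[|?]]]]] ?] [[|[|[|[|[|?]]]]] ?] [[|[|[|[|[|?]]]]] ?].
move: omega2; rewrite -eq_chi /chi; case: ex_minnP => k /existsP[f /forallP fP] _ k2.
pose w i : induced A := exist _ (v i) (vA i).
pose g i := f (w i).
have gP i j : cycle5 i j -> (g i != g j :> nat).
  rewrite -edge_v => ij; rewrite val_eqE.
  exact: (implyP (forallP (fP (w i)) (w j)) ij).
have gk i : g i < k by [].
have := gP (inord 0) (inord 1); have := gP (inord 1) (inord 2).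
have := gP (inord 2) (inord 3); have := gP (inord 3) (inord 4).
have := gP (inord 4) (inord 0); rewrite /cycle5 !inordK //=.
have := gk (inord 0); have := gk (inord 1); have := gk (inord 2).
have := gk (inord 3); have := gk (inord 4).
(* At most two colours cannot alternate around a cycle of odd length. *)
move: (g _ : nat) (g _ : nat) (g _ : nat) (g _ : nat) (g _ : nat) => *; lia.
Qed.

(** * Submodules of the cyclic module and the primes they contain *)

Section ZnGraph.
Variables (n m : nat) (n_gt1 : 1 < n) (m_gt1 : 1 < m) (n_dvd_m : n %| m).

Local Notation V := (ZnMod m_gt1 n_gt1 n_dvd_m).

Lemma ideal_mul_submodule (I : {set 'Z_m}) :
  submodule (ideal_mul V I).
Proof.
apply/andP; split; first by apply/bigcapP => N /andP[/andP[]].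
apply/forallP => a; apply/forall_inP => x /bigcapP xI; apply/forall_inP => y /bigcapP yI.
apply/bigcapP => N NP; have /andP[/andP[_ /forallP/(_ a)/forall_inP NS] _] := NP.
exact: (forall_inP (NS x (xI N NP)) y (yI N NP)).
Qed.

Lemma val_natr (k : nat) : ((k%:R)%R : V) = k %% n :> nat.
Proof. exact: (val_Zp_nat n_gt1 k). Qed.

Lemma val_scale (a : 'Z_m) (x : V) : (a *: x)%R = a * x %% n :> nat.
Proof.
(* The modulus built into ['Z_n] is [(Zp_trunc n).+2], which equals [n] because [1 < n]. *)
transitivity ((a%:R : 'Z_n)%R * x %% (Zp_trunc n).+2); first by [].
by rewrite (val_Zp_nat n_gt1); move: (a : nat) (x : nat) => k l; rewrite Zp_cast // modnMml.
Qed.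

Lemma val_add (x y : V) : (x + y)%R = (x + y) %% n :> nat.
Proof.
transitivity ((x + y) %% (Zp_trunc n).+2); first by [].
by move: (x : nat) (y : nat) => k l; rewrite Zp_cast.
Qed.

Lemma val_natr_scale (k : nat) (x : V) : ((k%:R : 'Z_m) *: x)%R = k * x %% n :> nat.
Proof. by rewrite val_scale (val_Zp_nat m_gt1) -modnMml modn_dvdm // modnMml. Qed.

Lemma val_lt (x : V) : x < n.
Proof. by rewrite -[X in _ < X](Zp_cast n_gt1) ltn_ord. Qed.

Lemma val_eq0 (x : V) : (x == 0)%R = (x == 0 :> nat).
Proof. by []. Qed.

Lemma ZnMod_inj (x y : V) : x = y :> nat -> x = y.
Proof. exact: ord_inj. Qed.

(** The element n/p generates the minimal submodule of order p, so this set records the minimal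
    submodules inside [N]. Primes are encoded by their positions in [primes n], which makes the
    number of labels the number of prime divisors. *)
Definition prime_support (N : {set V}) : {set 'I_(size (primes n))} :=
  [set i : 'I_(size (primes n)) | ((n %/ nth 0 (primes n) i)%:R : V)%R \in N].

Lemma div_prime_neq0 p : p \in primes n -> (((n %/ p)%:R : V) != 0)%R.
Proof.
rewrite mem_primes => /and3P[p_pr n_gt0 pn].
rewrite val_eq0 val_natr modn_small ?ltn_Pdiv ?prime_gt1 //.
by rewrite -lt0n divn_gt0 ?prime_gt0 // dvdn_leq.
Qed.

Lemma submodule_scale (N : {set V}) a x : submodule N -> x \in N -> (a *: x)%R \in N.
Proof.
move=> /andP[N0 /forallP/(_ a)/forall_inP NP] /NP/forall_inP/(_ _ N0).
by rewrite addr0.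
Qed.

(** A nonzero common element [x] has the same multiples modulo n as g = gcd(x, n), a proper divisor
    of n. For a prime p dividing n/g, the element n/p is a multiple of g and so lies in both
    submodules. *)
Lemma prime_support_meet (N N' : {set V}) : submodule N -> submodule N' ->
  (N :&: N' != [set 0%R]) = (prime_support N :&: prime_support N' != set0).
Proof.
move=> NS NS'; apply/idP/set0Pn => [|[i]]; last first.
  rewrite !inE => /andP[iN iN']; apply: contraNneq (div_prime_neq0 (mem_nth 0 (ltn_ord i))).
  by move=> NN'; rewrite -in_set1 -NN' inE iN iN'.
have /andP[N0 _] := NS; have /andP[N0' _] := NS'.
rewrite eqEsubset sub1set inE N0 N0' !andbT => /subsetPn[x].
rewrite inE => /andP[xN xN']; rewrite inE val_eq0 -lt0n => x_gt0.
case: (egcdnP n x_gt0) => a b eq_ab _; set g := gcdn x n in eq_ab.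
have n_gt0 : 0 < n := ltnW n_gt1.
have g_gt0 : 0 < g by rewrite gcdn_gt0 x_gt0.
have gn : g %| n := dvdn_gcdr _ _.
have lt_gn : g < n := leq_ltn_trans (dvdn_leq x_gt0 (dvdn_gcdl _ _)) (val_lt x).
have ng_gt1 : 1 < n %/ g by rewrite ltn_divRL // mul1n.
pose p := pdiv (n %/ g).
have p_pr : prime p := pdiv_prime ng_gt1.
have png : p %| n %/ g := pdiv_dvd _.
have pn : p \in primes n.
  by rewrite mem_primes p_pr n_gt0 (dvdn_trans png) // dvdn_div.
have lt_p : index p (primes n) < size (primes n) by rewrite index_mem.
exists (Ordinal lt_p); rewrite !inE /= nth_index //.
(* Multiplying the Bezout relation [a * x = b * n + g] by n/(gp) turns g into n/p. *)
suff -> : ((n %/ p)%:R = ((n %/ g %/ p * a)%:R : 'Z_m) *: x)%R.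
  by rewrite !submodule_scale.
apply: ZnMod_inj; rewrite val_natr val_natr_scale -mulnA eq_ab mulnDr mulnA modnMDl.
by congr (_ %% _); rewrite divn_mulAC // divnK.
Qed.

Lemma Zn_graph_perfect : size (primes n) <= 4 -> perfect (Zn_graph m_gt1 n_gt1 n_dvd_m).
Proof.
move=> le4; pose L (I : Zn_graph m_gt1 n_gt1 n_dvd_m) := prime_support (ideal_mul V (val I)).
apply: (intersection_graph_perfect (L := L)); last by rewrite card_ord.
by move=> I J; rewrite -prime_support_meet //; apply: ideal_mul_submodule.
Qed.

(** * Ideals generated by divisors, and the 5-cycle from five primes *)

Definition multiples (d : nat) : {set 'Z_m} := [set x : 'Z_m | d %| x].

Lemma natr_multiples d k : d %| m -> ((k%:R)%R \in multiples d) = (d %| k).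
Proof. by move=> dm; rewrite inE (val_Zp_nat m_gt1) /dvdn modn_dvdm. Qed.

Lemma multiples_nontrivial d : d %| n -> 1 < d -> d < n -> nontrivial_ideal (multiples d).
Proof.
move=> dn d_gt1 d_ltn; have dm := dvdn_trans dn n_dvd_m.
have d_ltm : d < m := leq_trans d_ltn (dvdn_leq (ltnW m_gt1) n_dvd_m).
apply/and3P; split.
- apply/andP; split; first by rewrite inE dvdn0.
  apply/forallP => a; apply/forall_inP => x; rewrite inE => dx.
  apply/forall_inP => y; rewrite inE => dy.
  rewrite -[a]natr_Zp -[x]natr_Zp -[y]natr_Zp -natrM -natrD natr_multiples //.
  by rewrite dvdn_add // dvdn_mull.
- apply/eqP => /setP/(_ (d%:R)%R); rewrite natr_multiples // dvdnn inE => /esym/eqP.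
  by move/(congr1 val); rewrite /= (val_Zp_nat m_gt1) modn_small //; lia.
- apply/eqP => /setP/(_ (1%:R)%R); rewrite natr_multiples // inE dvdn1; lia.
Qed.

Lemma multiples_inj d d' : d %| m -> d' %| m -> multiples d = multiples d' -> d = d'.
Proof.
move=> dm dm' eq_dd'; apply/eqP; rewrite eqn_dvd.
by rewrite -(natr_multiples d' dm) eq_dd' natr_multiples // dvdnn
  -(natr_multiples d dm') -eq_dd' natr_multiples // dvdnn.
Qed.

(** The multiples of [d] form a submodule containing all the products; conversely [x] is itself the
    product of its residue, which lies in the ideal, and 1. *)
Lemma mem_ideal_mul_multiples d (x : V) : d %| n -> (x \in ideal_mul V (multiples d)) = (d %| x).
Proof.
move=> dn; have dm := dvdn_trans dn n_dvd_m; apply/bigcapP/idP => [|dx N /andP[_ /subsetP NP]].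
  move/(_ [set y : V | d %| y]); rewrite inE; apply; apply/andP; split.
    apply/andP; split; first by rewrite inE dvdn0.
    apply/forallP => a; apply/forall_inP => y; rewrite inE => dy.
    apply/forall_inP => z; rewrite inE => dz.
    rewrite inE val_add val_scale /dvdn modn_dvdm // -/(dvdn _ _) dvdn_add //.
    by rewrite /dvdn modn_dvdm // -/(dvdn _ _) dvdn_mull.
  apply/subsetP => _ /imset2P[a y ad _ ->]; rewrite inE in ad.
  by rewrite inE val_scale /dvdn modn_dvdm // -/(dvdn _ _) dvdn_mulr.
apply: NP; apply/imset2P; exists (x%:R : 'Z_m)%R (1%R : 'Z_n); rewrite ?natr_multiples //.
by apply: ZnMod_inj; rewrite val_natr_scale /= modn_small ?muln1 ?val_lt.
Qed.

(** The elements n/q and n/q' generate the subgroups of orders q and q' of a cyclic group, and these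
    meet in the subgroup of order gcd(q, q'). *)
Lemma multiples_meet q q' : q %| n -> q' %| n ->
  (ideal_mul V (multiples (n %/ q)) :&: ideal_mul V (multiples (n %/ q')) != [set 0%R]) =
  ~~ coprime q q'.
Proof.
move=> qn qn'; have n_gt0 := ltnW n_gt1.
have dn : n %/ q %| n by rewrite dvdn_div.
have dn' : n %/ q' %| n by rewrite dvdn_div.
have q0 : 0 < q := dvdn_gt0 n_gt0 qn.
have q0' : 0 < q' := dvdn_gt0 n_gt0 qn'.
congr (~~ _); apply/eqP/idP => [eq0|co]; last first.
  apply/setP => x; rewrite !inE !mem_ideal_mul_multiples //.
  apply/andP/eqP => [[]|->]; last by rewrite !dvdn0.
  rewrite !dvdn_divLR // => nx nx'; apply/ZnMod_inj/eqP.
  have : n %| gcdn (x * q) (x * q') by rewrite dvdn_gcd nx nx'.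
  by rewrite -muln_gcdr (eqP co) muln1 /dvdn modn_small ?val_lt.
apply: contraT => nco; have g_gt1 : 1 < gcdn q q'.
  by rewrite ltn_neqAle eq_sym nco gcdn_gt0 q0.
have gn : gcdn q q' %| n := dvdn_trans (dvdn_gcdl _ _) qn.
have lt_gn : n %/ gcdn q q' < n by rewrite ltn_Pdiv.
have : ((n %/ gcdn q q')%:R : V)%R \in [set 0%R].
  rewrite -eq0 inE !mem_ideal_mul_multiples // val_natr modn_small //.
  by rewrite !dvdn_divLR // !divn_mulAC // -!muln_divA ?dvdn_gcdl ?dvdn_gcdr // !dvdn_mulr.
rewrite in_set1 val_eq0 val_natr modn_small // -leqn0 leqNgt divn_gt0 ?(ltnW g_gt1) //.
by rewrite dvdn_leq.
Qed.

Lemma Zn_graph_not_perfect : 4 < size (primes n) -> ~ perfect (Zn_graph m_gt1 n_gt1 n_dvd_m).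
Proof.
move=> lt4.
pose p i := nth 0 (primes n) i.
have n_gt0 : 0 < n := ltnW n_gt1.
have pP (i : 'I_5) : prime (p i) /\ p i %| n.
  have : p i \in primes n by rewrite mem_nth // (leq_trans (ltn_ord i)).
  by rewrite mem_primes => /and3P[].
have co_p (i j : 'I_5) : coprime (p i) (p j) = (i != j).
  rewrite prime_coprime ?dvdn_prime2 ?(pP i).1 ?(pP j).1 //.
  by rewrite nth_uniq ?primes_uniq // (leq_trans (ltn_ord _)).
pose s (i : 'I_5) : 'I_5 := inord (i.+1 %% 5).
have sE (i : 'I_5) : s i = i.+1 %% 5 :> nat by rewrite inordK // ltn_mod.
pose q (i : 'I_5) := p i * p (s i).
have qn i : q i %| n.
  rewrite Gauss_dvd ?(pP _).2 // co_p -val_eqE /= sE.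
  by case: i => [[|[|[|[|[|?]]]]] ?].
have co_q i j : ~~ coprime (q i) (q j) = (i == j) || cycle5 i j.
  rewrite coprimeMl !coprimeMr !co_p /cycle5 -!val_eqE /= !sE.
  by case: i j => [[|[|[|[|[|?]]]]] ?] [[|[|[|[|[|?]]]]] ?].
have dn i : n %/ q i %| n by rewrite dvdn_div.
have q_gt1 i : 1 < q i.
  by rewrite (leq_trans (prime_gt1 (pP i).1)) // leq_pmulr // prime_gt0 ?(pP _).1.
have nt i : nontrivial_ideal (multiples (n %/ q i)).
  apply: multiples_nontrivial; rewrite ?ltn_Pdiv // ltn_divRL // mul1n.
  (* [q i] differs from [n] because the prime two places further, [p (s (s i))], divides [n] but not
     [q i]. *)
  rewrite ltn_neqAle dvdn_leq // andbT; apply/eqP => qin.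
  have := (pP (s (s i))).2; rewrite -qin; apply/negP.
  rewrite -prime_coprime ?(pP _).1 // coprimeMr !co_p -!val_eqE /= !sE.
  by case: i {qin} => [[|[|[|[|[|?]]]]] ?].
pose v i : Zn_graph m_gt1 n_gt1 n_dvd_m := exist _ (multiples (n %/ q i)) (nt i).
apply: (cycle5_not_perfect (v := v)) => i j.
have [->|neq] := eqVneq i j.
  by rewrite edge_irrefl /cycle5; case: j => [[|[|[|[|[|?]]]]] ?].
rewrite /edge /= /ideal_edge multiples_meet // co_q (negPf neq).
suff -> : v i != v j by [].
apply: contraNneq neq => /(congr1 val)/= /multiples_inj.
have dm k : n %/ q k %| m := dvdn_trans (dn k) n_dvd_m.
move=> /(_ (dm i) (dm j)) eq_d.
have eq_q : q i = q j.
  by apply/eqP; rewrite -(eqn_pmul2l (dvdn_gt0 n_gt0 (dn j))) -{1}eq_d !divnK.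
(* If [q i = q j], then [i] and [j] have the same closed neighbourhood in the 5-cycle. Closed
   neighbourhoods of distinct vertices already differ on the vertices 0 to 3. *)
have N k : (i == k) || cycle5 i k = (j == k) || cycle5 j k by rewrite -!co_q eq_q.
have := N (inord 0); have := N (inord 1); have := N (inord 2); have := N (inord 3).
rewrite /cycle5 -!val_eqE /= !inordK //=.
by case: i j {eq_d eq_q N} => [[|[|[|[|[|?]]]]] ?] [[|[|[|[|[|?]]]]] ?].
Qed.

End ZnGraph.

Theorem theorem8 (n m : nat) (n_gt1 : 1 < n) (m_gt1 : 1 < m) (n_dvd_m : n %| m) :
  perfect (Zn_graph m_gt1 n_gt1 n_dvd_m) <-> size (primes n) <= 4.
Proof.
split; last exact: Zn_graph_perfect.
by move=> perf; rewrite leqNgt; apply/negP => lt4; apply: Zn_graph_not_perfect perf.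
Qed.
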